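(* Let $\mu^+$ be a nonnegative finite Borel measure on $[0,1]$ such that $\mu^+([\overline s,1])>0$ for some $\overline s\in(0,1]$. Let $\Omega$ be an open and bounded subset of $\mathbb{R}^N$ with Lipschitz boundary, and let $u\in C(\mathbb{R}^N)\cap C^2(\Omega)$. If $\mu^+((0,1))>0$, assume also that $$\int_{[0,1]}c_{N,s}\int_{\mathbb{R}^N}\frac{|u(x)|}{1+|x|^{N+2s}}\,dx\,d\mu^+(s)<+\infty .$$ Suppose that $L^+_\mu u\ge 0$ in $\Omega$ (pointwise) and $u\ge 0$ in $\mathbb{R}^N\setminus\Omega$. Then $u\ge 0$ in $\Omega$. In addition, if $u(x_0)=0$ for some $x_0\in\Omega$, then $u\equiv 0$ in the connected component of $\Omega$ containing $x_0$, and in fact $u\equiv0$ in the whole of $\mathbb{R}^N$ provided that $\mu^+((0,1))>0$.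
   Context: For $s\in[0,1]$, $c_{N,s}:=\frac{2^{2s-1}\,\Gamma\left(\frac{N+2s}{2}\right)}{\pi^{N/2}\,\Gamma(2-s)}\,s(1-s)$, with $\Gamma$ the Gamma function (so $c_{N,0}=c_{N,1}=0$). For $s\in(0,1)$, $$(-\Delta)^s u(x):=c_{N,s}\int_{\mathbb{R}^N}\frac{2u(x)-u(x+y)-u(x-y)}{|y|^{N+2s}}\,dy,$$ and $(-\Delta)^0u:=u$, $(-\Delta)^1u:=-\Delta u$. The operator is $$L^+_\mu u(x):=\int_{[0,1]}(-\Delta)^su(x)\,d\mu^+(s)=\int_{(0,1)}(-\Delta)^su(x)\,d\mu^+(s)+\mu^+(\{0\})u(x)-\mu^+(\{1\})\Delta u(x).$$ *)

(* Defs.v *)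
From HB Require Import structures.
From mathcomp Require Import all_boot all_order all_algebra.
From mathcomp Require Import all_classical all_reals all_analysis.
Import Order.TTheory GRing.Theory Num.Theory.
Import numFieldNormedType.Exports.

Set Implicit Arguments.
Unset Strict Implicit.
Unset Printing Implicit Defensive.

Local Open Scope classical_set_scope.
Local Open Scope ring_scope.

(* The library norm `|x| on row vectors is the sup norm: it gives the right
   topology and bounded sets, but not the |y| of the kernels below. *)
Definition enorm (R : realType) (N : nat) (x : 'rV[R]_N) : R :=
  Num.sqrt (\sum_(i < N) x 0 i ^+ 2).

Section lebesgue_tuple.
Local Open Scope ereal_scope.
Variable R : realType.

Let leb : {sigma_finite_measure set (measurableTypeR R) -> \bar R} :=
  lebesgue_measure.

Definition cons_pair (N : nat)
    (p : measurableTypeR R * N.-tuple (measurableTypeR R)) :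
    N.+1.-tuple (measurableTypeR R) :=
  [the N.+1.-tuple (measurableTypeR R) of p.1 :: p.2].

(* N-dimensional Lebesgue measure on the Borel subsets of R^N, as an iterated
   product measure; lebesgue_tuple_box below gives the measure of boxes. *)
Fixpoint lebesgue_tuple (N : nat) :
    set (N.-tuple (measurableTypeR R)) -> \bar R :=
  match N with
  | 0 => \d_ [tuple]
  | N'.+1 => pushforward (lebesgue_measure \x @lebesgue_tuple N') (@cons_pair N')
  end.

Lemma measurable_cons_pair N : measurable_fun [set: _] (@cons_pair N).
Proof. exact: measurable_cons. Qed.

Let uncons N (t : N.+1.-tuple (measurableTypeR R)) :
    measurableTypeR R * N.-tuple (measurableTypeR R) :=
  (thead t, [tuple of behead t]).

Let measurable_uncons N : measurable_fun [set: _] (@uncons N).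
Proof.
by apply: measurable_fun_pair; [exact: measurable_tnth|exact: measurable_behead].
Qed.

Let cons_pairK N : cancel (@cons_pair N) (@uncons N).
Proof. by case=> a t; congr pair; apply: val_inj. Qed.

Section cons_measure.
Variables (N : nat)
  (m : {sigma_finite_measure set (N.-tuple (measurableTypeR R)) -> \bar R}).

Definition cons_measure := pushforward (leb \x m) (@cons_pair N).
Local Notation M := cons_measure.

Let mpre A : measurable A -> measurable (@cons_pair N @^-1` A).
Proof.
by move=> mA; rewrite -[X in measurable X]setTI; exact: measurable_cons_pair.
Qed.

Let M0 : M set0 = 0.
Proof. by rewrite /cons_measure /pushforward preimage_set0 measure0. Qed.

Let M_ge0 A : 0 <= M A.
Proof. by rewrite /cons_measure /pushforward; exact: (@measure_ge0 _ _ _ (leb \x m)). Qed.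

Let M_sigma_additive : semi_sigma_additive M.
Proof.
move=> F mF tF mUF; rewrite /cons_measure /pushforward preimage_bigcup.
apply: measure_semi_sigma_additive.
- by move=> n; exact: mpre.
- apply/trivIsetP => /= i j _ _ ij; rewrite -preimage_setI.
  by move/trivIsetP : tF => /(_ _ _ _ _ ij) ->//; rewrite preimage_set0.
- by rewrite -preimage_bigcup; exact: mpre.
Qed.

HB.instance Definition _ := isMeasure.Build _ _ _ M M0 M_ge0 M_sigma_additive.

Let M_sigma_finite : sigma_finite setT M.
Proof.
have /sigma_finiteP[F [TF ndF Foo]] := sigma_finiteT leb.
have /sigma_finiteP[G [TG ndG Goo]] := sigma_finiteT m.
exists (fun i => @uncons N @^-1` (F i `*` G i)).
  rewrite -preimage_bigcup (_ : \bigcup_i _ = setT) ?preimage_setT//.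
  rewrite -setXTT TF TG predeqE => -[x y]; split.
    by move=> [n _ []/= ? ?]; split; exists n.
  move=> [/= [i _ Fix] [k _ Gky]]; exists (maxn i k) => //; split.
  - by move: x Fix; exact/subsetPset/ndF/leq_maxl.
  - by move: y Gky; exact/subsetPset/ndG/leq_maxr.
move=> k; have [? ?] := Foo k; have [? ?] := Goo k; split.
  rewrite -[X in measurable X]setTI; apply: measurable_uncons => //.
  exact: measurableX.
rewrite /cons_measure /pushforward -comp_preimage (_ : _ \o _ = id); last first.
  by apply/funext => p; rewrite /= cons_pairK.
by rewrite preimage_id product_measure1E// lte_mul_pinfty// ge0_fin_numE.
Qed.

HB.instance Definition _ := Measure_isSigmaFinite.Build _ _ _ M M_sigma_finite.

Lemma cons_measure_exists :
  exists m' : {sigma_finite_measure set (N.+1.-tuple (measurableTypeR R)) -> \bar R},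
    (m' : set _ -> \bar R) = cons_measure.
Proof. by exists M. Qed.

End cons_measure.

Lemma lebesgue_tuple_exists N :
  exists m : {sigma_finite_measure set (N.-tuple (measurableTypeR R)) -> \bar R},
    (m : set _ -> \bar R) = @lebesgue_tuple N.
Proof.
elim: N => [|N [m mE]].
  by exists (\d_ ([tuple] : 0.-tuple (measurableTypeR R))).
by have [m' m'E] := cons_measure_exists m; exists m'; rewrite m'E /= -mE.
Qed.

Let lebesgue_tuple_meas N := projT1 (cid (lebesgue_tuple_exists N)).

Let lebesgue_tuple_measE N : @lebesgue_tuple N = lebesgue_tuple_meas N.
Proof. by rewrite /lebesgue_tuple_meas; case: cid. Qed.

Let lebesgue_tuple0 N : @lebesgue_tuple N set0 = 0.
Proof. by rewrite lebesgue_tuple_measE measure0. Qed.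

Let lebesgue_tuple_ge0 N A : 0 <= @lebesgue_tuple N A.
Proof. by rewrite lebesgue_tuple_measE measure_ge0. Qed.

Let lebesgue_tuple_sigma_additive N : semi_sigma_additive (@lebesgue_tuple N).
Proof.
rewrite lebesgue_tuple_measE.
exact: (@measure_semi_sigma_additive _ _ _ (lebesgue_tuple_meas N)).
Qed.

HB.instance Definition _ N := isMeasure.Build _ _ _ (@lebesgue_tuple N)
  (@lebesgue_tuple0 N) (@lebesgue_tuple_ge0 N) (@lebesgue_tuple_sigma_additive N).

Let lebesgue_tuple_sigma_finite N : sigma_finite setT (@lebesgue_tuple N).
Proof. by rewrite lebesgue_tuple_measE; exact: (@sigma_finiteT _ _ _ (lebesgue_tuple_meas N)). Qed.

HB.instance Definition _ N := Measure_isSigmaFinite.Build _ _ _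
  (@lebesgue_tuple N) (@lebesgue_tuple_sigma_finite N).

Lemma measurable_box N (A : 'I_N -> set (measurableTypeR R)) :
  (forall i, measurable (A i)) ->
  measurable [set t : N.-tuple (measurableTypeR R) | forall i, A i (tnth t i)].
Proof.
move=> mA; rewrite (_ : mkset _ =
    \big[setI/setT]_(i < N) ((@tnth N (measurableTypeR R) ^~ i) @^-1` A i)).
  apply: bigsetI_measurable => i _.
  by rewrite -[X in measurable X]setTI; exact: measurable_tnth.
by rewrite -bigcap_seq; apply/seteqP; split=> t /= H i;
  [move=> _; exact: H|apply: H; rewrite /= mem_index_enum].
Qed.

Lemma lebesgue_tuple_box N (A : 'I_N -> set (measurableTypeR R)) :
  (forall i, measurable (A i)) ->
  lebesgue_tuple [set t : N.-tuple (measurableTypeR R) | forall i, A i (tnth t i)] =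
  \prod_(i < N) lebesgue_measure (A i).
Proof.
elim: N A => [|N IH] A mA.
  rewrite big_ord0 /= diracE mem_set//= => i; by case: i.
rewrite big_ord_recl -IH//= /pushforward.
have mB := measurable_box (fun i => mA (lift ord0 i)).
rewrite -(product_measure1E leb (@lebesgue_tuple N) (mA ord0) mB).
congr product_measure1; apply/seteqP; split=> -[a t] /= H.
  split; first by have := H ord0.
  by move=> i; have := H (lift ord0 i); rewrite tnthS.
case: H => Ha Ht i.
by case: (unliftP ord0 i) => [j ->|->] //; rewrite tnthS; exact: Ht.
Qed.
End lebesgue_tuple.

Section operator.
Variable R : realType.
Local Notation lambda := (@lebesgue_measure R).

Section integral_RN.
Local Open Scope ereal_scope.

Definition integral_RN (N : nat) (f : 'rV[R]_N -> R) : \bar R :=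
  \int[@lebesgue_tuple R N]_t (f (\row_i tnth t i))%:E.

End integral_RN.

(* Euler's integral, used below only at z > 0. *)
Definition Gamma (z : R) : R :=
  \int[lambda]_(t in `]0, +oo[) (t `^ (z - 1) * expR (- t)).

Definition cNs (N : nat) (s : R) : R :=
  2 `^ (2 * s - 1) * Gamma ((N%:R + 2 * s) / 2) /
  (pi `^ (N%:R / 2) * Gamma (2 - s)) * (s * (1 - s)).

Section smoothness.
Variable N : nat.
Implicit Types (Omega : set 'rV[R]_N) (u : 'rV[R]_N -> R).

Definition partial (i : 'I_N) u : 'rV[R]_N -> R := 'D_(delta_mx 0 i) u.

Definition laplacian u (x : 'rV[R]_N) : R :=
  \sum_(i < N) partial i (partial i u) x.

Fixpoint Ck (k : nat) Omega u : Prop :=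
  {in Omega, continuous u} /\
  if k is k'.+1 then
    forall i, {in Omega, forall x, derivable u x (delta_mx 0 i)} /\
              Ck k' Omega (partial i u)
  else True.

End smoothness.

(* Near each boundary point, after the rotation or reflection Q of the axes,
   Omega is the region lying above the graph of a Lipschitz function of the
   first n coordinates. *)
Definition lipschitz_boundary (n : nat) (Omega : set 'rV[R]_n.+1) : Prop :=
  forall p, closure Omega p -> ~ interior Omega p ->
  exists (Q : 'M[R]_n.+1) (phi : 'rV[R]_n -> R) (K : R),
    [/\ Q *m Q^T = 1%:M,
        forall a b, `|phi a - phi b| <= K * enorm (a - b)
      & \forall x \near p,
          Omega x <-> phi (col' ord_max (x *m Q)) < (x *m Q) 0 ord_max].

Section fractional.
Variable N : nat.
Implicit Types (u : 'rV[R]_N -> R) (x : 'rV[R]_N).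
Local Open Scope ereal_scope.

(* The value for s outside [0, 1] is irrelevant: only s in [0, 1] is used. *)
Definition frac_laplacian (s : R) u x : \bar R :=
  if s == 0%R then (u x)%:E
  else if s == 1%R then (- laplacian u x)%:E
  else (cNs N s)%:E *
    integral_RN (fun y =>
      (2 * u x - u (x + y) - u (x - y)) / enorm y `^ (N%:R + 2 * s))%R.

(* Extended-real valued: no value is silently replaced by 0 when an integral
   diverges. *)
Definition Lmu (mu : set (measurableTypeR R) -> \bar R) u x : \bar R :=
  \int[mu]_(s in `[0%R, 1%R]) frac_laplacian s u x.

Definition tail_integral (mu : set (measurableTypeR R) -> \bar R) u : \bar R :=
  \int[mu]_(s in `[0%R, 1%R])
    ((cNs N s)%:E *
     integral_RN (fun x => `|u x| / (1 + enorm x `^ (N%:R + 2 * s)))%R).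

End fractional.
End operator.

(* Main.v *)
(* At a global minimum point [x] of [u] with [u x <= 0] every [frac_laplacian s u x]
   is nonpositive. If [mu ]0, 1[ > 0] and some second difference of [u] at [x] is
   positive, then for [s] in ]0, 1[ it is at most [- c s (1 - s)], whence
   [Lmu mu u x < 0]; this excludes a negative minimum (far from the bounded set
   [Omega], [u] is nonnegative) and forces [u = 0] when the minimum is [0].
   If [mu ]0, 1[ = 0], then [Lmu mu u = mu {0} u - mu {1} laplacian u] with
   [mu {1} > 0], and the classical weak and strong minimum principles apply.
   Derivatives enter only through second differences: [c t^2 <= g t + g (- t) - 2 g 0]
   for small [t] implies [c <= g'' 0]. *)
Require Import Defs.
From mathcomp Require Import all_boot all_order all_algebra.
From mathcomp Require Import all_classical all_reals all_analysis.
From mathcomp Require Import measurable_realfun ring lra.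
Import Order.TTheory GRing.Theory Num.Theory.
Import numFieldNormedType.Exports.

Set Implicit Arguments.
Unset Strict Implicit.

Local Open Scope classical_set_scope.
Local Open Scope ring_scope.

(** * Integral estimates that do not ask for measurability *)

Section integral_bounds.
Local Open Scope ereal_scope.
Context d (T : measurableType d) (R : realType).
Variable mu : {measure set T -> \bar R}.
Implicit Types (f g : T -> \bar R) (D A : set T).

(** The integral of a nonnegative function is a supremum over the simple functions below it, so a
    larger function has more competitors, measurable or not. *)
Lemma ge0_le_integral_nomeas D f g :
  (forall x, D x -> 0 <= f x) -> (forall x, D x -> f x <= g x) ->
  \int[mu]_(x in D) f x <= \int[mu]_(x in D) g x.
Proof.
move=> f0 fg; have g0 x : D x -> 0 <= g x by move=> Dx; rewrite (le_trans (f0 x Dx))// fg.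
rewrite !ge0_integralE//; apply: le_ereal_sup => _ [h /= hf <-]; exists h => //= x.
by rewrite (le_trans (hf x))// lee_restrict.
Qed.

Lemma ge0_integral_ge D A f (c : R) : measurable D -> measurable A -> A `<=` D ->
  (0 <= c)%R -> (forall x, D x -> 0 <= f x) -> (forall x, A x -> c%:E <= f x) ->
  c%:E * mu A <= \int[mu]_(x in D) f x.
Proof.
move=> mD mA AD c0 f0 fc.
have <- : \int[mu]_(x in D) (c * \1_A x)%:E = c%:E * mu A.
  under eq_integral do rewrite EFinM.
  rewrite ge0_integralZl_EFin//; last exact/measurable_EFinP/measurable_indic.
  by rewrite integral_indic// setIidl.
apply: ge0_le_integral_nomeas => x Dx; first by rewrite lee_fin mulr_ge0.
rewrite indicE; have [Ax|Ax] := boolP (x \in A); first by rewrite mulr1 fc// -inE.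
by rewrite mulr0 f0.
Qed.

Lemma le0_integral_le D A f (c : R) : measurable D -> measurable A -> A `<=` D ->
  (0 <= c)%R -> (forall x, D x -> f x <= 0) -> (forall x, A x -> f x <= (- c)%:E) ->
  \int[mu]_(x in D) f x <= - (c%:E * mu A).
Proof.
move=> mD mA AD c0 f0 fc.
(* The positive part of [f] vanishes, so only the integral of the negative part remains. *)
have -> : \int[mu]_(x in D) f x = - \int[mu]_(x in D) (- f x).
  rewrite integralE (eq_integral (cst 0)) ?integral0 ?add0e; last exact: le0_funeposE.
  by congr (- _); apply: eq_integral; exact: le0_funenegE.
rewrite leeN2; apply: ge0_integral_ge => // x; first by move=> Dx; rewrite oppe_ge0 f0.
by move=> Ax; rewrite leeNr fc.
Qed.

End integral_bounds.

(** * Second differences in one variable *)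

Section second_difference.
Context {R : realType}.

(** Differentiability of [g1] is assumed at 0 only. The mean value theorem is applied to
    [g t + g (- t) - c t^2], whose derivative would be negative just to the right of 0 if
    [a < c]. *)
Lemma second_difference_derive1 (g g1 : R -> R) (a c : R) :
  (\forall t \near (0 : R), is_derive (t : R) 1 g (g1 t)) ->
  is_derive (0 : R) 1 g1 a ->
  (\forall t \near (0 : R), c * t ^+ 2 <= g t + g (- t) - 2 * g 0) -> c <= a.
Proof.
move=> dg dg1 gc; rewrite leNgt; apply/negP => ac.
(* With this margin the slopes of [g1] on both sides of 0 stay below [(a + c) / 2 < c]. *)
have e0 : 0 < (c - a) / 2 by rewrite divr_gt0// subr_gt0.
have /cvgrPdist_lt /(_ _ e0) : (g1 h - g1 0) / h @[h --> 0^'] --> a.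
  have [dv <-] := dg1.
  have := dv; rewrite /derivable /derive /=.
  rewrite (_ : (fun h => _) = (fun h => (g1 h - g1 0) / h)) //.
  by apply/funext => h /=; rewrite addr0 [h%:A]mulr1 /GRing.scale/= mulrC.
rewrite near_withinE => slope.
have /nbhs_ballP[r /= r0 H] : \forall t \near (0 : R),
   [/\ is_derive (t : R) 1 g (g1 t), c * t ^+ 2 <= g t + g (- t) - 2 * g 0 &
       t != 0 -> `|a - (g1 t - g1 0) / t| < (c - a) / 2].
  by near=> t; split; near: t.
have {}H t : `|t| < r -> [/\ is_derive (t : R) 1 g (g1 t),
   c * t ^+ 2 <= g t + g (- t) - 2 * g 0 &
   t != 0 -> `|a - (g1 t - g1 0) / t| < (c - a) / 2].
  by move=> tr; apply: H; rewrite /ball/= sub0r normrN.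
pose b := r / 2; have b0 : 0 < b by rewrite divr_gt0.
have br : b < r by rewrite /b; lra.
pose h t := g t + g (- t) - c * t ^+ 2.
pose dh t := g1 t - g1 (- t) - 2 * c * t.
have Dh (t : R) : `|t| < r -> is_derive t 1 h (dh t).
  move=> tr; have [dgt _ _] := H _ tr.
  have dgNt : is_derive (- t) 1 g (g1 (- t)).
    by have [] := H (- t); rewrite ?normrN.
  have dN : is_derive t 1 (g \o -%R) (- g1 (- t)).
    have -> : - g1 (- t) = g1 (- t) *: (-1 : R) by rewrite /GRing.scale/= mulrN1.
    exact: is_derive1_comp.
  have -> : h = (g + (g \o -%R)) - (c \*: ((id : R -> R) ^+ 2)).
    by apply/funext => x; rewrite /h !fctE.
  apply: is_derive_eq; rewrite /dh /GRing.scale/= expr1 mulr1; ring.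
have [||t] := @MVT _ h dh 0 b b0.
- move=> t; rewrite in_itv/= => /andP[t0 tb]; apply: Dh.
  by rewrite gtr0_norm// (lt_trans tb).
- apply: derivable_within_continuous => t; rewrite in_itv/= => /andP[t0 tb].
  by apply: (@ex_derive _ _ _ _ _ _ (dh t)); apply: Dh; rewrite ger0_norm// (le_lt_trans tb).
rewrite in_itv/= => /andP[t0 tb] hE.
have tr : `|t| < r by rewrite gtr0_norm// (lt_trans tb).
have [_ _ /(_ (lt0r_neq0 t0)) s1] := H _ tr.
have s2 : - t != 0 -> `|a - (g1 (- t) - g1 0) / (- t)| < (c - a) / 2.
  by have [] := H (- t); rewrite ?normrN.
have hb : c * b ^+ 2 <= g b + g (- b) - 2 * g 0.
  by move: (H b); rewrite (gtr0_norm b0) => /(_ br)[].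
(* The hypothesis at [b] says [h b >= 2 * g 0 = h 0], so [dh] cannot be negative at the mean value
   point. *)
have : 0 <= dh t * (b - 0).
  by rewrite -hE /h oppr0 expr0n/= mulr0; lra.
rewrite subr0 pmulr_lge0//; apply/negP; rewrite -ltNge.
have {}s1 : (g1 t - g1 0) / t < (c + a) / 2.
  by move: s1; rewrite ltr_norml => /andP[s1 _]; lra.
have {}s2 : (g1 (- t) - g1 0) / (- t) < (c + a) / 2.
  by move: (s2); rewrite oppr_eq0 lt0r_neq0// => /(_ isT); rewrite ltr_norml => /andP[? _]; lra.
move: s1; rewrite ltr_pdivrMr// => s1.
move: s2; rewrite invrN mulrN -mulNr ltr_pdivrMr// => s2.
have := mulr_gt0 t0 e0.
rewrite /dh; nra.
Unshelve. all: by end_near. Qed.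

End second_difference.

(** * Lower bounds for the Laplacian at a point *)

Section laplacian_lower_bound.
Context {R : realType}.

Lemma is_derive_line (V : normedModType R) (u : V -> R) (p e : V) (t a : R) :
  is_derive (p + t *: e) e u a -> is_derive t 1 (fun s : R => u (p + s *: e)) a.
Proof.
have E : (fun h : R => h^-1 *: (((fun s : R => u (p + s *: e)) \o shift t) (h *: 1) -
      u (p + t *: e))) =
    (fun h : R => h^-1 *: ((u \o shift (p + t *: e)) (h *: e) - u (p + t *: e))).
  apply/funext => h /=; congr (_ *: (u _ - _)).
  by rewrite [h%:A]mulr1 scalerDl addrCA.
by case=> du <-; split; rewrite ?/derivable ?/derive E.
Qed.

Lemma second_difference_partial (N : nat) (Omega : set 'rV[R]_N) (u : 'rV[R]_N -> R)
    (p : 'rV[R]_N) (i : 'I_N) (c : R) :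
  open Omega -> Ck 2 Omega u -> Omega p ->
  (\forall t \near (0 : R), c * t ^+ 2 <=
     u (p + t *: delta_mx 0 i) + u (p - t *: delta_mx 0 i) - 2 * u p) ->
  c <= partial i (partial i u) p.
Proof.
move=> oO [_ /(_ i) [du [_ /(_ i) [ddu _]]]] Op H.
set e : 'rV[R]_N := delta_mx 0 i in H *.
have line0 : p + 0 *: e = p by rewrite scale0r addr0.
apply: (@second_difference_derive1 R (fun t => u (p + t *: e))
   (fun t => partial i u (p + t *: e))).
- have cl : (fun t : R => p + t *: e) @ 0 --> p.
    rewrite -[X in _ --> X]line0; apply: cvgD; first exact: cvg_cst.
    by apply: cvgZl; exact: cvg_id.
  have /cl : nbhs p Omega by apply: open_nbhs_nbhs; split.
  rewrite /= nbhs_simpl => HO; near=> t; have Ot : Omega (p + t *: e) by near: t.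
  by apply: is_derive_line; rewrite /partial -/e; apply/derivableP/du; rewrite inE.
- by apply: is_derive_line; rewrite line0 {2}/partial -/e; apply/derivableP/ddu; rewrite inE.
- by move: H; apply: filterS => t; rewrite line0 scaleNr.
Unshelve. all: by end_near. Qed.

Lemma second_difference_laplacian (N : nat) (Omega : set 'rV[R]_N)
    (u : 'rV[R]_N -> R) (p : 'rV[R]_N) (c : 'I_N -> R) :
  open Omega -> Ck 2 Omega u -> Omega p ->
  (forall i, \forall t \near (0 : R), c i * t ^+ 2 <=
     u (p + t *: delta_mx 0 i) + u (p - t *: delta_mx 0 i) - 2 * u p) ->
  \sum_i c i <= laplacian u p.
Proof.
by move=> oO C2 Op H; apply: ler_sum => i _; exact: (@second_difference_partial _ Omega).
Qed.

(** Since [u - v] has a local minimum at [p], small second differences of [u] at [p] dominate those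
    of [v]. A barrier [v] thus enters through polynomial identities, without computing its
    derivatives. *)
Lemma laplacian_ge_touching (N : nat) (Omega : set 'rV[R]_N)
    (u v : 'rV[R]_N -> R) (p : 'rV[R]_N) (c : 'I_N -> R) :
  open Omega -> Ck 2 Omega u -> Omega p ->
  (\forall x \near p, u p - v p <= u x - v x) ->
  (forall i t, c i * t ^+ 2 <=
     v (p + t *: delta_mx 0 i) + v (p - t *: delta_mx 0 i) - 2 * v p) ->
  \sum_i c i <= laplacian u p.
Proof.
move=> oO C2 Op mn H; apply: (second_difference_laplacian oO C2 Op) => i.
set e : 'rV[R]_N := delta_mx 0 i.
have cl k : (fun t : R => p + (k * t) *: e) @ 0 --> p.
  rewrite -[X in _ --> X]addr0 -(scale0r e) -[in X in _ --> X](mulr0 k).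
  apply: cvgD; first exact: cvg_cst.
  by apply: cvgZl; apply: cvgM; [exact: cvg_cst|exact: cvg_id].
have := cl (-1) _ mn; have := cl 1 _ mn; rewrite /= !nbhs_simpl => m1 m2.
near=> t.
have : u p - v p <= u (p + (1 * t) *: e) - v (p + (1 * t) *: e) by near: t.
have : u p - v p <= u (p + (-1 * t) *: e) - v (p + (-1 * t) *: e) by near: t.
rewrite mul1r mulN1r scaleNr => h1 h2.
have := H i t; rewrite -/e; lra.
Unshelve. all: by end_near. Qed.

End laplacian_lower_bound.

(** * Continuity of sums, products and translates *)

Section continuous_arith.
Context {R : realType} {T : topologicalType}.
Implicit Types f g : T -> R.

Lemma continuous_funD f g : continuous f -> continuous g -> continuous (fun x => f x + g x).
Proof. by move=> cf cg x; apply: cvgD; [exact: cf|exact: cg]. Qed.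

Lemma continuous_funB f g : continuous f -> continuous g -> continuous (fun x => f x - g x).
Proof. by move=> cf cg x; apply: cvgB; [exact: cf|exact: cg]. Qed.

Lemma continuous_funN f : continuous f -> continuous (fun x => - f x).
Proof. by move=> cf x; apply: cvgN; exact: cf. Qed.

Lemma continuous_funM f g : continuous f -> continuous g -> continuous (fun x => f x * g x).
Proof. by move=> cf cg x; apply: cvgM; [exact: cf|exact: cg]. Qed.

Lemma continuous_funZ (c : R) f : continuous f -> continuous (fun x => c * f x).
Proof. by move=> cf; apply: continuous_funM => // x; exact: cvg_cst. Qed.

Lemma continuous_dist (V : normedModType R) (z : V) : continuous (fun x : V => `|x - z|).
Proof. by move=> x; apply: cvg_norm; apply: cvgB; [exact: cvg_id|exact: cvg_cst]. Qed.

Lemma continuous_compD (V : normedModType R) (f : V -> R) (x : V) :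
  continuous f -> continuous (fun y => f (x + y)).
Proof.
move=> cf y; apply: (@continuous_comp _ _ _ (fun z : V => x + z) f); last exact: cf.
by apply: cvgD; [exact: cvg_cst|exact: cvg_id].
Qed.

Lemma continuous_compB (V : normedModType R) (f : V -> R) (x : V) :
  continuous f -> continuous (fun y => f (x - y)).
Proof.
move=> cf y; apply: (@continuous_comp _ _ _ (fun z : V => x - z) f); last exact: cf.
by apply: cvgB; [exact: cvg_cst|exact: cvg_id].
Qed.

End continuous_arith.

(** * Minima on compact sets and the Euclidean norm *)

Section compact_minimum.
Context {R : realType} {N : nat}.
Implicit Types (u : 'rV[R]_N -> R) (K : set 'rV[R]_N).

Lemma compact_minimizer u K : continuous u -> K !=set0 -> bounded_set K -> closed K ->
  exists2 p, K p & forall x, K x -> u p <= u x.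
Proof.
move=> cu K0 bK cK.
have [|p] := @EVT_min_rV R N u K K0 (bounded_closed_compact bK cK).
  exact: continuous_subspaceT.
rewrite inE => Kp H; exists p => // x Kx; apply: H; exact: mem_set.
Qed.

(** The square of [enorm]. Unlike the sup norm it is a quadratic polynomial along every coordinate
    line. *)
Definition sqnorm (x : 'rV[R]_N) : R := \sum_i x 0 i ^+ 2.

Lemma sqnorm_ge0 x : 0 <= sqnorm x.
Proof. by apply: sumr_ge0 => i _; exact: sqr_ge0. Qed.

Lemma continuous_sqnorm (y : 'rV[R]_N) : continuous (fun x : 'rV[R]_N => sqnorm (x - y)).
Proof.
rewrite /sqnorm; apply: (@continuous_big R _ +%R 0 xpredT add_continuous) => i _.
have cx : continuous (fun x : 'rV[R]_N => (x - y) 0 i).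
  have -> : (fun x : 'rV[R]_N => (x - y) 0 i) = (fun x => x 0 i - y 0 i).
    by apply/funext => z; rewrite !mxE.
  by apply: continuous_funB; [exact: coord_continuous|exact: cst_continuous].
by under eq_fun do rewrite expr2; exact: continuous_funM.
Qed.

Lemma sqnorm_ge_norm x : `|x| ^+ 2 <= sqnorm x.
Proof.
have -> : `|x| = mx_norm x by [].
have [->|x0] := eqVneq (mx_norm x) 0.
  by rewrite expr0n sqnorm_ge0.
have [[i j] /= ->] := mx_norm_neq0 x0.
rewrite (ord1 i) real_normK ?num_real// /sqnorm (bigD1 j)//= lerDl.
by apply: sumr_ge0 => k _; exact: sqr_ge0.
Qed.

Lemma norm_coord_le (x : 'rV[R]_N) i : `|x 0 i| <= `|x|.
Proof. rewrite [leRHS]mx_normrE; apply/bigmax_geP; right => /=.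
by exists (0, i).
Qed.

Lemma sqnorm_le_norm x : sqnorm x <= N%:R * `|x| ^+ 2.
Proof.
rewrite /sqnorm mulr_natl -[X in _ *+ X]card_ord -sumr_const; apply: ler_sum => i _.
by rewrite -real_normK ?num_real// ler_sqr ?nnegrE// norm_coord_le.
Qed.

Lemma sqnorm0 : sqnorm 0 = 0.
Proof. by rewrite /sqnorm big1// => i _; rewrite mxE expr0n. Qed.

Lemma sqnorm_eq0 x : sqnorm x = 0 -> x = 0.
Proof.
move=> x0; apply/eqP; rewrite -normr_eq0 -sqrf_eq0 eq_le sqr_ge0 andbT.
by rewrite -x0 sqnorm_ge_norm.
Qed.

Lemma sqnormD_line (x : 'rV[R]_N) i (t : R) :
  sqnorm (x + t *: delta_mx 0 i) = sqnorm x + 2 * x 0 i * t + t ^+ 2.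
Proof.
rewrite /sqnorm (bigD1 i)//= [in RHS](bigD1 i)//= !mxE !eqxx/= mulr1.
rewrite (eq_bigr (fun j => x 0 j ^+ 2)); first by ring.
by move=> j ji; rewrite !mxE eqxx/= (negbTE ji) mulr0 addr0.
Qed.

End compact_minimum.

(** * Classical minimum principles for [a * u - b * laplacian u] *)

Section elliptic.
Context {R : realType} {n : nat}.
Local Notation N := n.+1.
Variables (Omega : set 'rV[R]_N) (u : 'rV[R]_N -> R) (a b : R).
Hypotheses (oO : open Omega) (bO : bounded_set Omega).
Hypotheses (cu : continuous u) (C2 : Ck 2 Omega u).

Lemma bounded_sqnorm_ball : exists2 M : R, 0 < M & Omega `<=` [set x | sqnorm x <= M].
Proof.
have [M [_ /(_ (`|M| + 1))]] := bO.
rewrite (le_lt_trans (ler_norm M)) ?ltrDl// => /(_ isT) bM.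
exists (N%:R * (`|M| + 1) ^+ 2) => [|x /bM /= xM].
  by rewrite mulr_gt0 ?exprn_gt0 ?ltr_wpDl.
by rewrite (le_trans (sqnorm_le_norm x))// ler_pM2l// ler_sqr ?nnegrE ?addr_ge0.
Qed.

Lemma bounded_set_sqnorm (y : 'rV[R]_N) (M : R) (K : set 'rV[R]_N) :
  (forall x, K x -> sqnorm (x - y) <= M) -> bounded_set K.
Proof.
move=> KM; exists (M + 1 + `|y|); split; first exact: num_real.
move=> r rM x /KM xM; apply: ltW; apply: le_lt_trans rM.
rewrite -[x](subrK y); apply: (le_trans (ler_normD _ _)); rewrite lerD2r.
have := le_trans (sqnorm_ge_norm _) xM; have := sqr_ge0 (`|x - y| - 1); nra.
Qed.

Lemma closed_sqnorm_ball (y : 'rV[R]_N) (M : R) :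
  closed [set x : 'rV[R]_N | sqnorm (x - y) <= M].
Proof.
by apply: (closed_comp (f := fun x : 'rV[R]_N => sqnorm (x - y)) _ (@closed_le _ M)) =>
  x _; exact: continuous_sqnorm.
Qed.

Lemma ball_minimizer (M : R) (w : 'rV[R]_N -> R) : 0 <= M -> continuous w ->
  exists2 p, sqnorm p <= M & forall x, sqnorm x <= M -> w p <= w x.
Proof.
move=> M0 cw; apply: (@compact_minimizer _ _ w [set x | sqnorm x <= M]) => //.
- by exists 0; rewrite /= sqnorm0.
- by apply: (@bounded_set_sqnorm 0 M) => x /=; rewrite subr0.
- have := @closed_sqnorm_ball 0 M.
  by under eq_set do rewrite subr0.
Qed.

Hypotheses (a0 : 0 <= a) (b0 : 0 < b).
Hypothesis super : forall x, Omega x -> 0 <= a * u x - b * laplacian u x.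

(** Subtracting [e |x|^2] forces [laplacian u >= 2 e N > 0] at a minimum. The minimum is taken over
    a ball containing [Omega]; a negative value of [u] there puts the point in [Omega], where
    [super] fails. *)
Lemma elliptic_weak_minimum_principle :
  (forall x, ~ Omega x -> 0 <= u x) -> forall x, 0 <= u x.
Proof.
move=> out x1; rewrite leNgt; apply/negP => ux1.
have Ox1 : Omega x1 by apply: contrapT => /out; rewrite leNgt ux1.
have [M M0 OM] := bounded_sqnorm_ball.
(* The quadratic term is at most [- u x1 / 2] on the ball, so [u p <= u x1 / 2 < 0] at the minimum
   of [w]. *)
pose e := - u x1 / (2 * M).
have e0 : 0 < e by rewrite divr_gt0 ?mulr_gt0// oppr_gt0.
have eM : e * M = - u x1 / 2 by rewrite /e; field; rewrite gt_eqF.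
pose w x := u x - e * sqnorm x.
have cw : continuous w.
  have cs := @continuous_sqnorm R N 0.
  rewrite [X in continuous X](_ : _ = @sqnorm R N) in cs; last first.
    by apply/funext => x; rewrite subr0.
  by apply: continuous_funB; [exact: cu|exact: continuous_funZ].
have [p pM wp] := ball_minimizer (ltW M0) cw.
have up : u p < 0.
  have := wp _ (OM _ Ox1); rewrite /w => upx1.
  have := ler_wpM2l (ltW e0) pM; have := mulr_ge0 (ltW e0) (sqnorm_ge0 x1); lra.
have Op : Omega p by apply: contrapT => /out; rewrite leNgt up.
have lap : \sum_(i < N) 2 * e <= laplacian u p.
  apply: (laplacian_ge_touching (v := fun x => e * sqnorm x) oO C2 Op).
    by apply: filterS (open_nbhs_nbhs (conj oO Op)) => x Ox; apply/wp/OM.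
  by move=> i t; rewrite sqnormD_line -scaleNr sqnormD_line; lra.
have lap0 : 0 < laplacian u p.
  by apply: lt_le_trans lap; rewrite sumr_const card_ord pmulrn_lgt0// mulr_gt0.
have := super Op; have := mulr_gt0 b0 lap0; have := mulr_ge0_le0 a0 (ltW up); lra.
Qed.

(* Hopf's barrier. Let [y] be a point near [z] with [u y > 0], [z1] a nearest zero
   of [u] (in the Euclidean distance), and [p x := |z1 - y|^2 - |x - y|^2], which is
   positive exactly on the largest ball about [y] free of zeros. For [k] large
   [v := p + k p^2 - |x - z1|^2] is a strict subsolution near [z1], vanishes at
   [z1], and is negative outside that ball except at [z1]. For [e] small
   [u - e v] is thus positive on a small sphere about [z1] but not at [z1], so it
   has an interior minimum, where the two inequalities for [u] and [v] clash. *)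
Lemma elliptic_zero_set_open (z : 'rV[R]_N) :
  (forall x, 0 <= u x) -> Omega z -> u z = 0 -> \forall x \near z, u x = 0.
Proof.
move=> u0 Oz uz.
have /nbhs_ballP[r /= r0 rO] := open_nbhs_nbhs (conj oO Oz).
(* Passing between sup and Euclidean norms costs a factor at most [N], so
   [|z - z1| <= (N + 1) |z - y| < r] and the nearest zero [z1] stays in [Omega]. *)
apply/nbhs_ballP; exists (r / N.+1%:R); rewrite /= ?divr_gt0// => y.
rewrite -ball_normE /= ltr_pdivlMr// => zy.
apply/eqP; rewrite eq_le u0 andbT leNgt; apply/negP => uy.
(* Restricting to the closed ball about [y] through [z] makes the set of zeros compact, and [z]
   keeps it nonempty. *)
have [z1 [uz1 z1z] z1min] : exists2 z1,
    ([set x | u x = 0] `&` [set x | sqnorm (x - y) <= sqnorm (z - y)]) z1 &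
    forall x, ([set x | u x = 0] `&` [set x | sqnorm (x - y) <= sqnorm (z - y)]) x ->
      sqnorm (z1 - y) <= sqnorm (x - y).
  apply: (@compact_minimizer _ _ (fun x => sqnorm (x - y))).
  - exact: continuous_sqnorm.
  - by exists z; split => /=.
  - by apply: (@bounded_set_sqnorm y (sqnorm (z - y))) => x [].
  - apply: closedI; last exact: closed_sqnorm_ball.
    by apply: (closed_comp (f := u) _ (@closed_eq _ 0)) => x _; exact: cu.
rewrite /= in uz1 z1z.
have Oz1 : Omega z1.
  apply: rO; rewrite -ball_normE /=; apply: le_lt_trans zy.
  have z1y : `|z1 - y| <= N%:R * `|z - y|.
    rewrite -ler_sqr ?nnegrE ?mulr_ge0// (le_trans (sqnorm_ge_norm _))//.
    rewrite (le_trans z1z)// (le_trans (sqnorm_le_norm _))// exprMn ler_wpM2r ?sqr_ge0//.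
    by rewrite -natrX ler_nat leq_pmulr.
  have -> : z - z1 = (z - y) - (z1 - y) by rewrite opprB addrA subrK.
  rewrite (le_trans (ler_normB _ _))// mulrC -natr1; lra.
pose R0 := sqnorm (z1 - y).
have R00 : 0 < R0.
  rewrite lt_def sqnorm_ge0 andbT; apply/eqP => /sqnorm_eq0/eqP.
  by rewrite subr_eq0 => /eqP z1y; move: uy; rewrite -z1y uz1 ltxx.
have inside x : sqnorm (x - y) < R0 -> 0 < u x.
  move=> xR; rewrite lt_def u0 andbT; apply/eqP => ux.
  have : R0 <= sqnorm (x - y).
    by apply: z1min; split => //=; apply: ltW; apply: lt_le_trans z1z.
  by rewrite leNgt xR.
(* With this choice [S z1 = - 4 N + 8 k R0 = 4 N > 0], as [p z1 = 0]. *)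
pose k := N%:R / R0.
have k0 : 0 < k by rewrite divr_gt0.
pose p x := R0 - sqnorm (x - y).
pose v x := p x + k * p x ^+ 2 - sqnorm (x - z1).
(* [S] is the Laplacian of [v]: in direction [i], [p] contributes [- 2], [k p^2] contributes
   [- 4 k p + 8 k (x - y)_i^2], and [- |x - z1|^2] contributes [- 2]. *)
pose S x := \sum_(i < N) (- 4 - 4 * k * p x + 8 * k * (x - y) 0 i ^+ 2).
have pz1 : p z1 = 0 by rewrite /p subrr.
have vz1 : v z1 = 0 by rewrite /v pz1 subrr sqnorm0 expr0n/= mulr0 addr0 subr0.
have SE x : S x = N%:R * (- 4 - 4 * k * p x) + 8 * k * sqnorm (x - y).
  rewrite /S big_split /= sumr_const card_ord.
  by rewrite -[X in X + _ = _]mulr_natl /sqnorm mulr_sumr.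
have Sz1 : 0 < S z1.
  rewrite SE pz1 -/R0 /k mulr0 subr0 -mulrA divfK ?gt_eqF//.
  have : (0 : R) < N%:R by [].
  lra.
have cp : continuous p.
  by apply: continuous_funB; [exact: cst_continuous|exact: continuous_sqnorm].
have cv : continuous v.
  apply: continuous_funB; last exact: continuous_sqnorm.
  apply: continuous_funD => //; apply: continuous_funZ.
  by under eq_fun do rewrite expr2; exact: continuous_funM.
have cS : continuous S.
  have -> : S = (fun x => N%:R * (- 4 - 4 * k * p x) + 8 * k * sqnorm (x - y)).
    exact/funext/SE.
  apply: continuous_funD; apply: continuous_funZ; last exact: continuous_sqnorm.
  by apply: continuous_funB; [exact: cst_continuous|exact: continuous_funZ].
have near_z1 : \forall x \near z1,
    [/\ Omega x, 0 < 1 + k * p x & 0 < b * S x - a * v x].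
  have n1 : \forall x \near z1, 0 < 1 + k * p x.
    have c1 : continuous (fun x => 1 + k * p x).
      by apply: continuous_funD; [exact: cst_continuous|exact: continuous_funZ].
    by apply: cvgr_gt (c1 z1) _ _; rewrite pz1; lra.
  have n2 : \forall x \near z1, 0 < b * S x - a * v x.
    have c2 : continuous (fun x => b * S x - a * v x).
      by apply: continuous_funB; exact: continuous_funZ.
    by apply: cvgr_gt (c2 z1) _ _; rewrite vz1 mulr0 subr0 mulr_gt0.
  have n3 := open_nbhs_nbhs (conj oO Oz1).
  by near=> x; split; near: x.
have {near_z1}[d d0 near_z1] : exists2 d : R, 0 < d & forall x, `|x - z1| <= d ->
    [/\ Omega x, 0 < 1 + k * p x & 0 < b * S x - a * v x].
  move/nbhs_ballP: near_z1 => [d /= d0 H]; exists (d / 2); first by rewrite divr_gt0.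
  move=> x xz; apply: H; rewrite -ball_normE /= distrC (le_lt_trans xz)//.
  by rewrite ltr_pdivrMr// ltr_pMr// ltr1n.
have cnorm := @continuous_dist R 'rV[R]_N z1.
have bball K : (forall x, K x -> `|x - z1| <= d) -> bounded_set K.
  move=> Kd; exists (d + `|z1|); split; first exact: num_real.
  move=> t dt x /Kd xd; apply: ltW; apply: le_lt_trans dt.
  by rewrite -[x](subrK z1) (le_trans (ler_normD _ _))// lerD2r.
(* From [v x >= 0] follows [p (1 + k p) >= |x - z1|^2 > 0]; as [1 + k p > 0], also [p > 0], so [x]
   is in the ball free of zeros. *)
have sphere_pos x : `|x - z1| = d -> 0 <= v x -> 0 < u x.
  move=> xd vx; apply: inside; rewrite -subr_gt0 -/(p x).
  have [_ kp _] := near_z1 x (eq_ind_r (fun t => t <= d) (lexx d) xd).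
  have sx : 0 < sqnorm (x - z1).
    by apply: lt_le_trans (sqnorm_ge_norm _); rewrite xd exprn_gt0.
  rewrite -(pmulr_lgt0 _ kp) mulrC; move: vx; rewrite /v; lra.
have [e e0 he] : exists2 e, 0 < e & forall x, `|x - z1| = d -> 0 < u x - e * v x.
  pose K := [set x : 'rV[R]_N | `|x - z1| = d] `&` [set x | 0 <= v x].
  have [K0|K0] := pselect (K !=set0); last first.
    exists 1 => // x xd; rewrite mul1r subr_gt0; apply: lt_le_trans (u0 x).
    by rewrite ltNge; apply/negP => vx; apply: K0; exists x.
  have bK : bounded_set K by apply: bball => x [/= ->].
  have cK : closed K.
    apply: closedI.
      by apply: (closed_comp (f := fun x : 'rV[R]_N => `|x - z1|) _ (@closed_eq _ d)) =>
        x _; exact: cnorm.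
    by apply: (closed_comp (f := v) _ (@closed_ge _ 0)) => x _; exact: cv.
  have [q1 [q1d q1v] q1min] := compact_minimizer (@cu) K0 bK cK.
  have cNv : continuous (fun x => - v x) by exact: continuous_funN.
  have [q2 [q2d q2v] q2max] := compact_minimizer cNv K0 bK cK.
  have uq1 : 0 < u q1 by exact: sphere_pos.
  rewrite /= in q2v.
  have v1 : 0 < v q2 + 1 by lra.
  (* On [K], [u q1] is the least value of [u] and [v q2] the largest of [v]; the [+ 1] makes
     [e v < u] strict. *)
  exists (u q1 / (v q2 + 1)) => [|x xd]; first by rewrite divr_gt0.
  have e0 : 0 < u q1 / (v q2 + 1) by rewrite divr_gt0.
  have eE : u q1 / (v q2 + 1) * (v q2 + 1) = u q1 by rewrite divfK// gt_eqF.
  have [vx|vx] := ltP (v x) 0.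
    by have := u0 x; have := mulr_gt0 e0 (_ : 0 < - v x); rewrite oppr_gt0 => /(_ vx); lra.
  have := q1min x (conj xd vx); have := ler_wpM2l (ltW e0) (q2max x (conj xd vx)); lra.
pose w x := u x - e * v x.
have cw : continuous w.
  by apply: continuous_funB; [exact: cu|exact: continuous_funZ].
have [q qd qmin] : exists2 q, [set x | `|x - z1| <= d] q &
    forall x, [set x | `|x - z1| <= d] x -> w q <= w x.
  apply: compact_minimizer => //.
  - by exists z1; rewrite /= subrr normr0 ltW.
  - exact: bball.
  - by apply: (closed_comp (f := fun x : 'rV[R]_N => `|x - z1|) _ (@closed_le _ d)) =>
      x _; exact: cnorm.
have wq : w q <= 0.
  by have := qmin z1; rewrite /= subrr normr0 (ltW d0) /w uz1 vz1 mulr0 subr0; apply.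
have {}qd : `|q - z1| < d.
  rewrite lt_def qd andbT; apply/eqP => /esym qd'.
  by have := he q qd'; rewrite ltNge wq.
have [Oq kpq Sq] := near_z1 q (ltW qd).
have lap : \sum_(i < N) e * (- 4 - 4 * k * p q + 8 * k * (q - y) 0 i ^+ 2) <= laplacian u q.
  apply: (laplacian_ge_touching (v := fun x => e * v x) oO C2 Oq).
    have : \forall x \near q, `|x - z1| < d by apply: cvgr_lt (cnorm q) _ qd.
    by apply: filterS => x /ltW; exact: qmin.
  move=> i t; rewrite /v /p.
  have E (c : 'rV[R]_N) : q + t *: delta_mx 0 i - c = (q - c) + t *: delta_mx 0 i.
    by rewrite addrAC.
  have E' (c : 'rV[R]_N) : q - t *: delta_mx 0 i - c = (q - c) + (- t) *: delta_mx 0 i.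
    by rewrite addrAC scaleNr.
  rewrite !E !E' !sqnormD_line.
  set s1 := sqnorm (q - y); set s2 := sqnorm (q - z1).
  set y1 := (q - y) 0 i; set y2 := (q - z1) 0 i.
  (* The square in [k p^2] leaves exactly this quartic excess over the quadratic term. *)
  rewrite -subr_ge0 [leRHS](_ : _ = 2 * e * k * t ^+ 4); last by ring.
  apply: mulr_ge0; last by rewrite exprn_even_ge0.
  exact: mulr_ge0 (mulr_ge0 (ler0n _ 2) (ltW e0)) (ltW k0).
move: lap; rewrite -mulr_sumr -/(S q) => lap.
(* At [q], [w q <= 0] gives [a u <= a e v], whence [a u - b laplacian u <= - e (b S - a v) < 0]. *)
have := super Oq; have := ler_wpM2l (ltW b0) lap.
have := ler_wpM2l a0 wq; have := mulr_gt0 e0 Sq; rewrite /w; lra.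
Unshelve. all: by end_near. Qed.

(** The zero set is closed by continuity and open in [Omega] by [elliptic_zero_set_open], so it
    fills the connected component. *)
Lemma elliptic_strong_minimum_principle (x0 : 'rV[R]_N) :
  (forall x, 0 <= u x) -> Omega x0 -> u x0 = 0 ->
  forall x, connected_component Omega x0 x -> u x = 0.
Proof.
move=> u0 Ox0 ux0 x Cx.
set C := connected_component Omega x0.
suff CE : C `&` [set y | u y = 0] = C by move: Cx; rewrite -/C -CE => -[].
have Cx0 : C x0 by exact: connected_component_refl.
apply: (@component_connected _ Omega x0).
- by exists x0.
- exists [set y | u y = 0]^°; first exact: open_interior.
  apply/seteqP; split=> y [Cy]; last by move=> /interior_subset.
  move=> uy; split => //; apply: elliptic_zero_set_open => //.
  exact: (@connected_component_sub _ Omega x0).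
- exists [set y | u y = 0] => //.
  by apply: (closed_comp (f := u) _ (@closed_eq _ 0)) => y _; exact: cu.
Qed.

End elliptic.

(** * Bounds for the Gamma function and for [cNs] *)

Section gamma_bounds.
Context {R : realType}.
Local Notation lambda := (@lebesgue_measure R).
Implicit Types z t : R.

Lemma derive1_NinvD1sqrt t : 0 < t ->
  is_derive t 1 (fun x : R => - (1 + Num.sqrt x)^-1)
    ((2 * Num.sqrt t)^-1 * (1 + Num.sqrt t) ^- 2).
Proof.
move=> t0; have s0 : 1 + Num.sqrt t != 0 by rewrite gt_eqF// ltr_pwDl// sqrtr_ge0.
have ds := is_derive1_sqrt t0.
have dg : is_derive t 1 (fun x : R => 1 + Num.sqrt x) (2 * Num.sqrt t)^-1.
  by rewrite -[X in is_derive _ _ _ X]add0r; apply: is_deriveD.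
have dV := is_deriveV (f := fun x : R => 1 + Num.sqrt x) s0 dg; have dN := is_deriveN dV.
apply: (is_derive_eq dN); rewrite /GRing.scale/= mulNr opprK mulrC //.
Qed.

(* The majorant has the primitive [-1 / (1 + sqrt t)], so it is integrable
   at both ends. *)
Definition gamma_majorant t : R := (2 * Num.sqrt t)^-1 * (1 + Num.sqrt t) ^- 2.

Lemma expDX_le_expR t m : 0 <= t -> (1 + t) ^+ m <= m`!%:R * expR 1 * expR t.
Proof.
move=> t0; case: m => [|m].
  by rewrite expr0 fact0 mul1r -expRD -expR0 ler_expR addr_ge0.
have := @expR_ge1Dxn R (1 + t) m (addr_ge0 ler01 t0); rewrite expRD => H.
rewrite -mulrA -ler_pdivrMl ?ltr0n ?fact_gt0// mulrC.
by apply: le_trans H; rewrite lerDr.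
Qed.

(** Splitting off [t^(-1/2)] leaves the exponent [z - 1/2 >= 0], so [(1 + t)^m] bounds the power for
    all [z] in [[1/2, m]] at once. With [(1 + sqrt t)^2 <= 2 (1 + t)] it is absorbed by [expR t]. *)
Lemma gamma_integrand_le z t m : 1 / 2 <= z -> z <= m%:R -> 0 < t ->
  t `^ (z - 1) * expR (- t) <= 4 * m.+1`!%:R * expR 1 * gamma_majorant t.
Proof.
move=> z1 zm t0.
have s0 : 0 < Num.sqrt t by rewrite sqrtr_gt0.
have st : Num.sqrt t ^+ 2 = t by rewrite sqr_sqrtr// ltW.
have E : t `^ (z - 1) = t `^ (z - 1 / 2) / Num.sqrt t.
  rewrite -powR12_sqrt ?ltW// -powRN -powRD; last by rewrite (gt_eqF t0) implybT.
  by congr (_ `^ _); field.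
have B : t `^ (z - 1 / 2) <= (1 + t) ^+ m.
  rewrite -powR_mulrn ?addr_ge0 ?(ltW t0)//.
  apply: (@le_trans _ _ ((1 + t) `^ (z - 1 / 2))).
    by rewrite ge0_ler_powR ?nnegrE ?subr_ge0 ?addr_ge0 ?lerDr ?(ltW t0).
  by rewrite ler_powR ?lerDl ?(ltW t0)//; lra.
have C : (1 + Num.sqrt t) ^+ 2 <= 2 * (1 + t).
  by have := sqr_ge0 (1 - Num.sqrt t); lra.
have D := expDX_le_expR m.+1 (ltW t0).
have e0 : 0 < expR t := expR_gt0 _.
have s1 : 0 < 1 + Num.sqrt t by rewrite ltr_wpDl.
have key : t `^ (z - 1 / 2) * (1 + Num.sqrt t) ^+ 2 <= 2 * (m.+1`!%:R * expR 1 * expR t).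
  apply: (@le_trans _ _ ((1 + t) ^+ m * (2 * (1 + t)))).
    by rewrite ler_pM ?powR_ge0 ?sqr_ge0.
  by rewrite mulrCA ler_pM2l// -exprSr.
rewrite E /gamma_majorant expRN; move: s0 s1 e0 key.
move: (Num.sqrt t) (expR t) (t `^ (z - 1 / 2)) => s X A s0 s1 e0 key.
rewrite [leLHS](_ : _ = A * (1 + s) ^+ 2 / (s * (1 + s) ^+ 2 * X)); last first.
  by field; rewrite !gt_eqF.
rewrite [leRHS](_ : _ = 2 * (m.+1`!%:R * expR 1 * X) / (s * (1 + s) ^+ 2 * X)); last first.
  by field; rewrite !gt_eqF.
by rewrite ler_wpM2r// invr_ge0 !mulr_ge0 ?sqr_ge0// ltW.
Qed.

Local Open Scope ereal_scope.

Lemma gamma_majorant_ge0 t : (0 <= gamma_majorant t)%R.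
Proof.
by rewrite /gamma_majorant mulr_ge0 ?invr_ge0 ?mulr_ge0 ?sqrtr_ge0 ?exprn_ge0 ?addr_ge0
  ?sqrtr_ge0.
Qed.

Lemma continuous_gamma_majorant t : (0 < t)%R -> {for t, continuous gamma_majorant}.
Proof.
move=> t0; have s0 : (0 < Num.sqrt t)%R by rewrite sqrtr_gt0.
have cs := @sqrt_continuous R t.
apply: cvgM.
  apply: cvgV; first by rewrite gt_eqF// mulr_gt0.
  by apply: cvgM; [exact: cvg_cst|exact: cs].
apply: cvgV; first by rewrite gt_eqF// exprn_gt0// ltr_wpDl.
have cs1 : (1 + Num.sqrt x)%R @[x --> t] --> (1 + Num.sqrt t)%R.
  by apply: cvgD; [exact: cvg_cst|exact: cs].
by under eq_fun do rewrite expr2; rewrite expr2; exact: (cvgM cs1 cs1).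
Qed.

Lemma integral_gamma_majorant_itv (e : R) : (0 < e)%R ->
  \int[lambda]_(t in `[e, +oo[) (gamma_majorant t)%:E <= 1.
Proof.
move=> e0.
have D t : (e < t)%R -> is_derive t 1%R (fun x : R => - (1 + Num.sqrt x)^-1)%R (gamma_majorant t).
  by move=> et; apply: derive1_NinvD1sqrt; exact: lt_trans et.
rewrite (@ge0_continuous_FTC2y R gamma_majorant (fun x => - (1 + Num.sqrt x)^-1)%R e 0).
- rewrite sub0e -EFinN opprK lee_fin invf_le1; last by rewrite ltr_pwDl ?sqrtr_ge0.
  by rewrite lerDl sqrtr_ge0.
- by move=> x _; exact: gamma_majorant_ge0.
- apply: continuous_in_subspaceT => x; rewrite inE/= in_itv/= andbT => ex.
  by apply: continuous_gamma_majorant; exact: lt_le_trans ex.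
- rewrite -oppr0; apply: cvgN; apply/gtr0_cvgV0.
    by near=> x; rewrite ltr_pwDl// sqrtr_ge0.
  apply/cvgryPge => A; near=> x.
  have xA : (A ^+ 2 <= x)%R by near: x; apply: nbhs_pinfty_ge; exact: num_real.
  have x0 : (0 <= x)%R := le_trans (sqr_ge0 A) xA.
  rewrite (@le_trans _ _ (Num.sqrt x))// ?lerDr//.
  by rewrite (le_trans (ler_norm A))// -sqrtr_sqr ler_wsqrtr.
- by move=> x /D [].
- apply: cvg_at_right_filter; apply: cvgN; apply: cvgV.
    by rewrite gt_eqF// ltr_pwDl// sqrtr_ge0.
  by apply: cvgD; [exact: cvg_cst|exact: sqrt_continuous].
- by move=> x; rewrite in_itv/= andbT => ex; rewrite derive1E; apply: derive_val; exact: D.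
Unshelve. all: by end_near. Qed.

Lemma measurable_gamma_majorant :
  measurable_fun (`]0%R, +oo[%classic : set (measurableTypeR R)) gamma_majorant.
Proof.
apply: open_continuous_measurable_fun; first exact: interval_open.
by move=> x; rewrite inE/= in_itv/= andbT => x0; exact: continuous_gamma_majorant.
Qed.

Lemma integral_gamma_majorant : \int[lambda]_(t in `]0%R, +oo[) (gamma_majorant t)%:E <= 1.
Proof.
(* The majorant is unbounded near 0, so the half-line is exhausted by intervals on which the bound 1
   is uniform. *)
pose F (k : nat) := `[(k.+1%:R^-1 : R)%R, +oo[%classic.
have FE : `]0%R, +oo[%classic = \bigcup_k F k.
  apply/seteqP; split=> [x|x [k _]]; rewrite /F /= !in_itv/= !andbT.
    move=> x0; exists (Num.trunc x^-1) => //=; rewrite in_itv/= andbT.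
    rewrite invf_ple ?posrE//; apply: ltW; exact: truncnS_gt.
  by apply: lt_le_trans; rewrite invr_gt0.
have ndF : nondecreasing_seq F.
  move=> i j ij; rewrite subsetEset => x; rewrite /F/= !in_itv/= !andbT.
  by apply: le_trans; rewrite lef_pV2 ?posrE// ler_nat.
have F0 k x : F k x -> (0 < x)%R.
  by rewrite /F/= in_itv/= andbT; apply: lt_le_trans; rewrite invr_gt0.
have cvF : \int[lambda]_(t in F i) (gamma_majorant t)%:E @[i --> \oo] -->
    \int[lambda]_(t in \bigcup_i F i) (gamma_majorant t)%:E.
  apply: ge0_nondecreasing_set_cvg_integral => //.
  - by move=> i; exact: measurable_itv.
  - move=> i; apply/measurable_EFinP; apply: measurable_funS measurable_gamma_majorant => //.
    by move=> x /F0 /= x0; rewrite in_itv/= x0.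
  - by move=> i x _; rewrite lee_fin gamma_majorant_ge0.
rewrite FE -(cvg_lim _ cvF)//; apply: lime_le; first exact: cvgP cvF.
by near=> k; exact: integral_gamma_majorant_itv.
Unshelve. all: by end_near. Qed.

(** For the lower bound only [[1, 2]] is kept, where [t^(z - 1) >= 1 / t >= 1 / 2]; for the upper
    one the majorant has integral at most 1. *)
Lemma Gamma_bounds z (m : nat) : (1 / 2 <= z)%R -> (z <= m%:R)%R ->
  (expR (- 2) / 2 <= Gamma z <= 4 * m.+1`!%:R * expR 1)%R.
Proof.
move=> z1 zm; set C := (4 * _ * _)%R.
have C0 : (0 <= C)%R by rewrite !mulr_ge0 ?expR_ge0.
have f0 t : (0 <= t `^ (z - 1) * expR (- t))%R by rewrite mulr_ge0 ?powR_ge0 ?expR_ge0.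
have lo : (expR (- 2) / 2)%:E <= \int[lambda]_(t in `]0%R, +oo[) (t `^ (z - 1) * expR (- t))%:E.
  have l12 : lambda `[1%R, 2%R]%classic = 1.
    rewrite lebesgue_measure_itv/= lte_fin ltr1n/= -EFinB.
    by congr EFin; lra.
  rewrite -[leLHS]mule1 -l12; apply: ge0_integral_ge => //.
  - by move=> t; rewrite /= !in_itv/= andbT => /andP[t1 _]; exact: lt_le_trans t1.
  - by move=> t _; rewrite lee_fin.
  - move=> t; rewrite /= in_itv/= lee_fin mulrC => /andP[t1 t2].
    have t0 : (0 < t)%R by exact: lt_le_trans t1.
    apply: ler_pM; rewrite ?invr_ge0 ?expR_ge0//; last by rewrite ler_expR lerN2.
    apply: (@le_trans _ _ (t `^ (- 1))%R); last by rewrite ler_powR//; lra.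
    by rewrite powR_inv1 ?(ltW t0)// lef_pV2 ?posrE.
have hi : \int[lambda]_(t in `]0%R, +oo[) (t `^ (z - 1) * expR (- t))%:E <= C%:E.
  apply: (@le_trans _ _ (\int[lambda]_(t in `]0%R, +oo[) (C%:E * (gamma_majorant t)%:E))).
    apply: ge0_le_integral_nomeas => t; rewrite /= in_itv/= andbT => t0; first by rewrite lee_fin.
    rewrite -EFinM lee_fin; exact: gamma_integrand_le.
  rewrite ge0_integralZl_EFin//; last by apply/measurable_EFinP; exact: measurable_gamma_majorant.
    rewrite -[leRHS]mule1 lee_pmul2l ?integral_gamma_majorant// lte_fin.
    by rewrite !mulr_gt0 ?expR_gt0 ?ltr0n ?fact_gt0.
  by move=> x _; rewrite lee_fin gamma_majorant_ge0.
(* [Rintegral] sends [+oo] to 0, so even the lower bound relies on [hi] to exclude an infinite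
   integral. *)
move: lo hi; rewrite /Gamma /Rintegral.
by case: (\int[lambda]_(t in _) _) => [r| |]//=; rewrite !lee_fin => -> ->.
Qed.

Lemma cNs_ge (N : nat) : (0 < N)%N ->
  exists2 c : R, (0 < c)%R & forall s : R, (0 < s < 1)%R -> (c * (s * (1 - s)) <= cNs N s)%R.
Proof.
move=> N0; pose P : R := (pi `^ (N%:R / 2))%R; pose C : R := (4 * 3`!%:R * expR 1)%R.
have P0 : (0 < P)%R by rewrite powR_gt0// pi_gt0.
have C0 : (0 < C)%R by rewrite !mulr_gt0 ?expR_gt0.
have e0 := expR_gt0 (- 2 : R).
(* The factors bound [2^(2s - 1)] and the upper Gamma value from below; [C] bounds [Gamma (2 - s)]
   from above, with [m = 2]. *)
exists (2^-1 * (expR (- 2) / 2) / (P * C))%R; first by rewrite !(mulr_gt0, invr_gt0).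
move=> s /andP[s0 s1]; rewrite /cNs -/P.
have N1 : (1 <= N%:R :> R)%R by rewrite ler1n.
have /andP[G1 _] : (expR (- 2) / 2 <= Gamma ((N%:R + 2 * s) / 2) <= 4 * N.+2`!%:R * expR 1)%R.
  by have NS : (N%:R + 1 = N.+1%:R :> R)%R := natr1 _; apply: Gamma_bounds; lra.
have /andP[G2 G2C] : (expR (- 2) / 2 <= Gamma (2 - s) <= C)%R by apply: Gamma_bounds; lra.
have G20 : (0 < Gamma (2 - s))%R by apply: lt_le_trans G2; rewrite divr_gt0.
rewrite ler_wpM2r//; first by rewrite mulr_ge0// ltW// subr_gt0.
apply: ler_pM.
- by rewrite !mulr_ge0 ?invr_ge0// ltW.
- by rewrite invr_ge0 mulr_ge0 ?ltW.
- apply: ler_pM => //.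
  by rewrite -powR_inv1// ler_powR ?ler1n//; lra.
- by rewrite lef_pV2 ?posrE ?mulr_gt0// ler_pM2l.
Qed.

End gamma_bounds.

(** * Discarding a null set on which the integrand is arbitrary *)

Section integral_null.
Local Open Scope ereal_scope.
Context d (T : measurableType d) (R : realType).
Variable mu : {measure set T -> \bar R}.
Implicit Types (f : T -> \bar R) (D A : set T).

(* [f] will be [s |-> frac_laplacian s u x], which need not be measurable on ]0, 1[. *)
Lemma ge0_integral_restrictC_null D A f : measurable D -> measurable A -> mu A = 0 ->
  (forall x, D x -> 0 <= f x) -> measurable_fun D (f \_ (~` A)) ->
  \int[mu]_(x in D) f x = \int[mu]_(x in D) (f \_ (~` A)) x.
Proof.
move=> mD mA A0 f0 mf; apply/eqP; rewrite eq_le; apply/andP; split; last first.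
  apply: ge0_le_integral_nomeas => x Dx; rewrite patchE; case: ifPn => // _; exact: f0.
have fA0 x : D x -> 0 <= (f \_ (~` A)) x.
  by move=> Dx; rewrite patchE; case: ifPn => // _; exact: f0.
(* The value [+oo] on the null set [A] adds nothing to the integral, yet yields a measurable
   majorant of [f]. *)
have mA' : measurable_fun D (cst +oo \_ A : T -> \bar R).
  apply: measurable_funS (measurableT) _ _ => //.
  exact/(measurable_restrictT _ _).1.
have oo0 x : D x -> 0 <= (cst +oo \_ A : T -> \bar R) x.
  by move=> _; rewrite patchE; case: ifPn => //= _; exact: leey.
have -> : \int[mu]_(x in D) (f \_ (~` A)) x =
    \int[mu]_(x in D) ((f \_ (~` A)) x + (cst +oo \_ A) x).
  rewrite ge0_integralD//.
  rewrite -(integral_mkcondr mu D A (cst +oo)) [X in _ + X]integral_cst; last exact: measurableI.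
  by rewrite (subset_measure0 _ _ _ A0) ?mule0 ?adde0//; exact: measurableI.
apply: ge0_le_integral_nomeas => x Dx; first exact: f0.
rewrite !patchE; have [xA|xA] := boolP (x \in A); rewrite in_setC xA /= ?adde0//.
by rewrite add0e leey.
Qed.

Lemma integral_restrictC_null D A f : measurable D -> measurable A -> mu A = 0 ->
  measurable_fun D (f \_ (~` A)) ->
  \int[mu]_(x in D) f x = \int[mu]_(x in D) (f \_ (~` A)) x.
Proof.
move=> mD mA A0 mf; rewrite [LHS]integralE [RHS]integralE.
rewrite funepos_restrict funeneg_restrict; congr (_ - _);
  apply: ge0_integral_restrictC_null => //.
- by rewrite -funepos_restrict; exact: measurable_funepos.
- by rewrite -funeneg_restrict; exact: measurable_funeneg.
Qed.

End integral_null.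

(** * The operator when []0, 1[] is a null set *)

Section local_case.
Local Open Scope ereal_scope.
Context (R : realType) (mu : {finite_measure set (measurableTypeR R) -> \bar R}).

(** Off the null set only the two endpoints remain, so the integrand can be replaced by a
    combination of two point indicators. *)
Lemma Lmu_local N (u : 'rV[R]_N -> R) x : mu `]0%R, 1%R[%classic = 0 ->
  Lmu mu u x = (fine (mu [set 0%R]) * u x - fine (mu [set 1%R]) * laplacian u x)%:E.
Proof.
move=> mu0; rewrite /Lmu.
have D0 : [set 0%R] `<=` (`[0%R, 1%R]%classic : set (measurableTypeR R)).
  by move=> _ /= ->; rewrite in_itv/= lexx ler01.
have D1 : [set 1%R] `<=` (`[0%R, 1%R]%classic : set (measurableTypeR R)).
  by move=> _ /= ->; rewrite in_itv/= lexx ler01.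
pose h (c : R) (a : R) (s : measurableTypeR R) : \bar R := (c * \1_[set a] s)%:E.
have mh (D : set (measurableTypeR R)) c a : measurable_fun D (h c a).
  by apply/measurable_EFinP; apply: measurable_funM.
have ind a : mu.-integrable `[0%R, 1%R]%classic
    (fun s => (\1_([set a] : set (measurableTypeR R)) s)%:E).
  by apply: (integrableS measurableT) => //; apply: integrable_indic; exact: measurable_set1.
have ih c a : mu.-integrable `[0%R, 1%R]%classic (h c a).
  under [X in integrable _ _ X]eq_fun do rewrite /h EFinM.
  by apply: integrableZl => //; exact: ind.
have Ih c a : ([set a] `<=` (`[0%R, 1%R]%classic : set (measurableTypeR R))) ->
    \int[mu]_(s in `[0%R, 1%R]) h c a s = (c * fine (mu [set a]))%:E.
  move=> aD; under eq_integral do rewrite /h EFinM.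
  have ma : measurable ([set a] : set (measurableTypeR R)) by exact: measurable_set1.
  rewrite (integralZl _ (ind a))//.
  by rewrite integral_indic// setIidl// EFinM fineK// fin_num_measure.
pose f s : \bar R := frac_laplacian s u x.
have fE : {in `[0%R, 1%R]%classic, f \_ (~` `]0%R, 1%R[) =1
    (fun s => h (u x) 0%R s + h (- laplacian u x)%R 1%R s)}.
  move=> s; rewrite inE/= in_itv/= => /andP[s0 s1].
  rewrite patchE /h/= /f /frac_laplacian !indicE !in_set1.
  have [->|sn0] := eqVneq s 0%R.
    rewrite eq_sym oner_eq0 mulr0 mulr1 adde0 ifT//.
    by apply/mem_set; rewrite /= in_itv/= ltxx.
  have [->|sn1] := eqVneq s 1%R.
    rewrite mulr0 mulr1 add0e ifT//.
    by apply/mem_set; rewrite /= in_itv/= ltxx andbF.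
  rewrite !mulr0 adde0 ifF//; apply/negP => /set_mem; apply.
  by rewrite /= in_itv/= !lt_def sn0 s0 eq_sym sn1.
rewrite (@integral_restrictC_null _ _ _ mu `[0%R, 1%R]%classic `]0%R, 1%R[%classic f)//; last first.
  apply: (eq_measurable_fun (fun s => h (u x) 0%R s + h (- laplacian u x)%R 1%R s)).
    by move=> s /fE ->.
  by apply: emeasurable_funD; exact: mh.
transitivity (\int[mu]_(s in `[0%R, 1%R]) (h (u x) 0%R s + h (- laplacian u x)%R 1%R s)).
  by apply: eq_integral => s /fE.
rewrite (integralD _ (ih _ _) (ih _ _))//.
by rewrite !Ih// -EFinD; congr EFin; ring.
Qed.

End local_case.


(** * Strict negativity of the operator when []0, 1[] has mass *)

Section nonlocal_case.
Local Open Scope ereal_scope.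
Context (R : realType) (mu : {finite_measure set (measurableTypeR R) -> \bar R}).

(** Countably many such intervals cover []0, 1[], so they cannot all be null. On one of them
    [s (1 - s) >= d^2], a bound uniform in [s]. *)
Lemma itvoo_shrink_gt0 : 0 < mu `]0%R, 1%R[%classic ->
  exists2 d : R, (0 < d)%R & 0 < mu `]d, (1 - d)%R[%classic.
Proof.
move=> mu0; apply: contrapT => H.
have : mu `]0%R, 1%R[%classic = 0; last by move=> E; rewrite E ltxx in mu0.
pose F (k : nat) : set (measurableTypeR R) := `](k.+1%:R^-1)%R, (1 - k.+1%:R^-1)%R[%classic.
have FE : `]0%R, 1%R[%classic `<=` \bigcup_k F k.
  move=> s; rewrite /= in_itv/= => /andP[s0 s1].
  have m0 : (0 < Num.min s (1 - s))%R by rewrite lt_min s0 subr_gt0.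
  exists (Num.truncn (Num.min s (1 - s))^-1)%R => //; rewrite /F/= in_itv/=.
  have : ((Num.truncn (Num.min s (1 - s))^-1).+1%:R^-1 < Num.min s (1 - s))%R.
    by rewrite invf_plt ?posrE// truncnS_gt.
  by rewrite lt_min => /andP[-> ?]; rewrite ltrBrDl -ltrBrDr.
have mF k : measurable (F k) by exact: measurable_itv.
have mUF : measurable (\bigcup_k F k) by exact: bigcup_measurable.
have U0 : mu (\bigcup_k F k) = 0.
  apply: measure_negligible => //.
  apply: negligible_bigcup => k; apply/negligibleP => //; apply/eqP.
  rewrite eq_le measure_ge0 andbT leNgt.
  by apply/negP => Fk; apply: H; exists (k.+1%:R^-1)%R; rewrite ?invr_gt0.
by apply/eqP; rewrite -measure_le0 -U0 le_measure ?inE.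
Qed.

Lemma integral_RN_box_le n (f : 'rV[R]_n.+1 -> R) (y0 : 'rV[R]_n.+1) (r c : R) :
  (0 < r)%R -> (0 <= c)%R -> (forall y, f y <= 0)%R ->
  (forall y, (`|y - y0| < r)%R -> (f y <= - c)%R) ->
  integral_RN f <= - (c * (r ^+ n.+1))%:E.
Proof.
move=> r0 c0 f0 fc; rewrite /integral_RN.
(* Half-sides [r / 2] keep the closed box inside the open sup-norm ball of radius [r]. *)
pose I (i : 'I_n.+1) : set (measurableTypeR R) := `[(y0 0 i - r / 2)%R, (y0 0 i + r / 2)%R]%classic.
pose B := [set t : n.+1.-tuple (measurableTypeR R) | forall i, I i (tnth t i)].
have mI i : measurable (I i) by exact: measurable_itv.
have mB : measurable B := measurable_box mI.
have lB : lebesgue_tuple B = (r ^+ n.+1)%:E.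
  rewrite /B lebesgue_tuple_box// (eq_bigr (fun=> r%:E)) => [|i _].
    by rewrite prodEFin prodr_const card_ord.
  rewrite /I lebesgue_measure_itv/= lte_fin ifT; last by lra.
  by rewrite -EFinB; congr EFin; field.
rewrite EFinM -lB; apply: (@le0_integral_le _ _ _ _ setT B) => //.
- by move=> t _; rewrite lee_fin.
- move=> t Bt; rewrite lee_fin; apply: fc.
  have : (`|(\row_i tnth t i : 'rV[R]_n.+1) - y0| <= r / 2)%R.
    rewrite [leLHS]mx_normrE; apply: bigmax_le => [|[i j] _]; first by rewrite divr_ge0 ?ltW.
    have := Bt j; rewrite /I/= in_itv/= !mxE (ord1 i) ler_norml => /andP[? ?].
    by apply/andP; split; lra.
  by move=> /le_lt_trans; apply; rewrite ltr_pdivrMr// ltr_pMr// ltr1n.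
Qed.

(** The signs of [u x] and [laplacian u x] settle [s = 0] and [s = 1]. For [s] in between, the
    second difference is positive on a ball about [y0], where the kernel is bounded below uniformly
    in [s]. *)
Lemma Lmu_lt0 n (u : 'rV[R]_n.+1 -> R) (x y0 : 'rV[R]_n.+1) :
  0 < mu `]0%R, 1%R[%classic -> continuous u ->
  (u x <= 0)%R -> (0 <= laplacian u x)%R ->
  (forall y, 2 * u x <= u (x + y) + u (x - y))%R ->
  (2 * u x < u (x + y0) + u (x - y0))%R ->
  Lmu mu u x < 0.
Proof.
move=> mu0 cu ux Lx H Hy0.
pose g y : R := (u (x + y) + u (x - y) - 2 * u x)%R.
have g0 y : (0 <= g y)%R by rewrite /g subr_ge0.
have cg : continuous g.
  apply: continuous_funB; last exact: cst_continuous.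
  by apply: continuous_funD; [exact: continuous_compD|exact: continuous_compB].
have gy0 : (0 < g y0)%R by rewrite /g subr_gt0.
have [r r0 gr] : exists2 r : R, (0 < r)%R & forall y, (`|y - y0| < r)%R -> (g y0 / 2 < g y)%R.
  have : \forall y \near y0, (g y0 / 2 < g y)%R.
    by apply: cvgr_gt (cg y0) _ _; rewrite ltr_pdivrMr// ltr_pMr// ltr1n.
  move/nbhs_ballP => [r /= r0 Hr]; exists r => // y yr; apply: Hr.
  by rewrite -ball_normE/= distrC.
(* [M] bounds [enorm] on the ball; [M >= 1] makes [M^(N + 2s) <= M^(N + 2)], with [N = n.+1]. *)
pose M : R := (1 + n.+1%:R * (`|y0| + r) ^+ 2)%R.
have M1 : (1 <= M)%R by rewrite lerDl mulr_ge0 ?sqr_ge0.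
have enM y : (`|y - y0| < r)%R -> (enorm y <= M)%R.
  move=> yr; rewrite /enorm -/(sqnorm y).
  have yn : (`|y| <= `|y0| + r)%R.
    by rewrite -[y in leLHS](subrK y0) (le_trans (ler_normD _ _))// addrC lerD2l ltW.
  have s1 : (sqnorm y <= M ^+ 2)%R.
    apply: (@le_trans _ _ M); last by rewrite expr2 ler_peMr// (le_trans ler01).
    apply: (le_trans (sqnorm_le_norm y)); rewrite /M ler_wpDl// ler_wpM2l//.
    by rewrite ler_sqr ?nnegrE// (le_trans _ yn).
  rewrite (le_trans (ler_wsqrtr s1))// sqrtr_sqr ger0_norm//.
  exact: le_trans M1.
pose P : R := (M `^ (n.+1%:R + 2))%R.
have P0 : (0 < P)%R by rewrite powR_gt0// (lt_le_trans ltr01).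
pose c : R := (g y0 / 2 / P * r ^+ n.+1)%R.
have c0 : (0 < c)%R by rewrite mulr_gt0 ?exprn_gt0 ?divr_gt0.
have [c1 c10 cN] := @cNs_ge R n.+1 isT.
have [d d0 mud] := itvoo_shrink_gt0 mu0.
have Ic s : (0 < s < 1)%R ->
    integral_RN (fun y =>
      (2 * u x - u (x + y) - u (x - y)) / enorm y `^ (n.+1%:R + 2 * s))%R
    <= (- c)%:E.
  move=> /andP[s0 s1]; rewrite EFinN.
  apply: (@integral_RN_box_le n _ y0 r) => //.
  - by rewrite !divr_ge0// ltW.
  - by move=> y; rewrite mulr_le0_ge0 ?invr_ge0 ?powR_ge0//; have := g0 y; rewrite /g; lra.
  - move=> y yr; have gy := gr y yr.
    (* At [y = 0] the kernel would take the default value 0, but there [g] vanishes, against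
       [gy]. *)
    have y0' : (0 < enorm y)%R.
      rewrite lt_def sqrtr_ge0 andbT; apply/eqP => e0.
      have /eqP : (sqnorm y = 0)%R.
        by apply/eqP; rewrite eq_le sqnorm_ge0 andbT -sqrtr_eq0; exact/eqP.
      move=> /eqP /sqnorm_eq0 yE; move: gy; rewrite yE /g addr0 subr0; lra.
    have eP : (enorm y `^ (n.+1%:R + 2 * s) <= P)%R.
      apply: (@le_trans _ _ (M `^ (n.+1%:R + 2 * s))%R).
        apply: ge0_ler_powR; rewrite ?nnegrE; last exact: enM.
        - by rewrite addr_ge0// mulr_ge0// ltW.
        - exact: ltW.
        - exact: le_trans M1.
      by rewrite ler_powR// lerD2l; lra.
    have e0 : (0 < enorm y `^ (n.+1%:R + 2 * s))%R by rewrite powR_gt0.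
    rewrite -lerN2 opprK -mulNr.
    apply: ler_pM; last by rewrite lef_pV2 ?posrE.
    - by rewrite divr_ge0// ltW.
    - by rewrite invr_ge0 ltW.
    - by move: gy; rewrite /g; lra.
pose a : R := (c1 * (d * d) * c)%R.
have a0 : (0 < a)%R := mulr_gt0 (mulr_gt0 c10 (mulr_gt0 d0 d0)) c0.
apply: (@le_lt_trans _ _ (- (a%:E * mu `]d, (1 - d)%R[%classic))); last first.
  rewrite oppe_lt0; apply: mule_gt0; [by rewrite lte_fin|exact: mud].
have fs s : (0 < s < 1)%R -> frac_laplacian s u x <= (- (c1 * (s * (1 - s)) * c))%:E.
  move=> /andP[s0 s1]; have s01 : (0 < s < 1)%R by rewrite s0.
  rewrite /frac_laplacian (gt_eqF s0) (lt_eqF s1).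
  have cs := cN s s01.
  have cs0 : (0 < c1 * (s * (1 - s)))%R by rewrite !mulr_gt0// subr_gt0.
  have cs1 : (0 <= cNs n.+1 s)%R by apply: le_trans cs; exact: ltW.
  apply: (@le_trans _ _ ((cNs n.+1 s)%:E * (- c)%:E)).
    by rewrite lee_wpmul2l ?lee_fin// Ic.
  by rewrite -EFinM lee_fin mulrN lerN2 ler_wpM2r// ltW.
apply: le0_integral_le => //.
- by move=> s; rewrite /= !in_itv/= => /andP[ds sd]; apply/andP; split; lra.
- exact: ltW.
- move=> s; rewrite /= in_itv/= => /andP[s0 s1].
  have [->|sn0] := eqVneq s 0%R; first by rewrite /frac_laplacian eqxx lee_fin.
  have [->|sn1] := eqVneq s 1%R.
    by rewrite /frac_laplacian oner_eq0 eqxx lee_fin oppr_le0.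
  have s01 : (0 < s < 1)%R by rewrite !lt_def sn0 s0 eq_sym sn1.
  apply: (le_trans (fs s s01)); rewrite lee_fin oppr_le0.
  have s1' : (0 <= 1 - s)%R by rewrite subr_ge0.
  exact: mulr_ge0 (mulr_ge0 (ltW c10) (mulr_ge0 s0 s1')) (ltW c0).
- move=> s; rewrite /= in_itv/= => /andP[ds sd].
  have s01 : (0 < s < 1)%R by apply/andP; split; lra.
  apply: (le_trans (fs s s01)); rewrite lee_fin lerN2 /a ler_wpM2r ?(ltW c0)//.
  rewrite ler_wpM2l ?(ltW c10)// ler_pM ?(ltW d0) ?(ltW ds)//.
  by lra.
Qed.

End nonlocal_case.

(** * The Laplacian at a minimum, and the mass at [s = 1] *)

Section minimum_at_point.
Context {R : realType} {n : nat}.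

Lemma laplacian_ge0_at_min (Omega : set 'rV[R]_n.+1) (u : 'rV[R]_n.+1 -> R) p :
  open Omega -> Ck 2 Omega u -> Omega p -> (forall x, u p <= u x) -> 0 <= laplacian u p.
Proof.
move=> oO C2 Op pmin; have <- : \sum_(i < n.+1) (0 : R) = 0 by rewrite big1.
apply: (second_difference_laplacian oO C2 Op) => i; near=> t.
by rewrite mul0r; have := pmin (p + t *: delta_mx 0 i); have := pmin (p - t *: delta_mx 0 i); lra.
Unshelve. all: by end_near. Qed.

(** As [sbar > 0], the interval [[sbar, 1]] lies in the union of the null set []0, 1[] and the point
    1. *)
Lemma mass_at1_gt0 (mu : {finite_measure set (measurableTypeR R) -> \bar R}) (sbar : R) :
  0 < sbar -> (0 < mu `[sbar, 1%R]%classic)%E -> mu `]0%R, 1%R[%classic = 0%E ->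
  0 < fine (mu [set 1%R]).
Proof.
move=> s0 ms m0; rewrite fine_gt0// ltey_eq fin_num_measure ?andbT; last exact: measurable_set1.
apply: lt_le_trans ms _.
apply: (@le_trans _ _ (mu (`]0%R, 1%R[%classic `|` [set 1%R]))).
  apply: le_measure; rewrite ?inE//.
    by apply: measurableU => //; exact: measurable_set1.
  move=> s; rewrite /= !in_itv/= => /andP[ss s1].
  have [->|sn1] := eqVneq s 1%R; first by right.
  by left; rewrite (lt_le_trans s0 ss) lt_def eq_sym sn1.
apply: (@le_trans _ _ (mu `]0%R, 1%R[%classic + mu [set 1%R])%E); last by rewrite m0 add0e.
by apply: measureU2 => //; exact: measurable_set1.
Qed.

End minimum_at_point.

(** * The minimum principle from the local and the nonlocal case *)

Unset Implicit Arguments.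

Theorem theorem1p2 (R : realType) (n : nat)
    (mu : {finite_measure set (measurableTypeR R) -> \bar R})
    (mu_supp : mu (~` `[0%R, 1%R]%classic) = 0%E)
    (mu_pos : exists sbar : R, 0 < sbar <= 1 /\ (0 < mu `[sbar, 1%R]%classic)%E)
    (Omega : set 'rV[R]_n.+1)
    (Omega_open : open Omega)
    (Omega_bounded : bounded_set Omega)
    (Omega_lipschitz : lipschitz_boundary Omega)
    (u : 'rV[R]_n.+1 -> R)
    (u_continuous : continuous u)
    (u_C2 : Ck 2 Omega u)
    (u_tail : (0 < mu `]0%R, 1%R[%classic)%E -> (tail_integral mu u < +oo)%E)
    (Lu_ge0 : forall x, Omega x -> (0 <= Lmu mu u x)%E)
    (u_ge0_out : forall x, ~ Omega x -> 0 <= u x) :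
  (forall x, Omega x -> 0 <= u x) /\
  (forall x0, Omega x0 -> u x0 = 0 ->
     (forall x, connected_component Omega x0 x -> u x = 0) /\
     ((0 < mu `]0%R, 1%R[%classic)%E -> forall x, u x = 0)).
Proof.
have [mu0|muN0] := boolP (0 < mu `]0%R, 1%R[%classic)%E; last first.
  have mu0 := muN0; rewrite -leNgt measure_le0 in mu0; move/eqP in mu0.
  have [sbar [/andP[s0 _] ms]] := mu_pos.
  have b0 := mass_at1_gt0 s0 ms mu0.
  have a0 : 0 <= fine (mu [set 0]) by rewrite fine_ge0.
  have super x : Omega x ->
      0 <= fine (mu [set 0]) * u x - fine (mu [set 1]) * laplacian u x.
    by move=> /Lu_ge0; rewrite Lmu_local// lee_fin.
  have u0 := elliptic_weak_minimum_principle Omega_open Omega_bounded u_continuous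
    u_C2 a0 b0 super u_ge0_out.
  split=> [x _|x0 Ox0 ux0]; first exact: u0.
  split; last by move=> mu0'; case/negP: muN0.
  exact: (elliptic_strong_minimum_principle Omega_open u_continuous u_C2 a0 b0 super).
have u0 x : 0 <= u x.
  rewrite leNgt; apply/negP => ux.
  have Ox : Omega x by apply: contrapT => /u_ge0_out; rewrite leNgt ux.
  have [M M0 OM] := bounded_sqnorm_ball Omega_bounded.
  have [p pM pmin] := ball_minimizer (ltW M0) u_continuous.
  have up : u p < 0 by apply: le_lt_trans ux; apply: pmin; exact: OM.
  have Op : Omega p by apply: contrapT => /u_ge0_out; rewrite leNgt up.
  (* The minimum over the ball is global, since [u >= 0 > u p] off [Omega]. *)
  have {}pmin y : u p <= u y.
    have [/OM|/u_ge0_out uy] := pselect (Omega y); first exact: pmin.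
    by apply: le_trans uy; exact: ltW.
  (* This displacement is so long that [p + y0] and [p - y0] both leave [Omega], where [u >= 0];
     hence the second difference at [p] is positive. *)
  pose y0 : 'rV[R]_n.+1 := const_mx (`|p| + M + 1).
  have out y : M + 1 <= `|y| -> 0 <= u y.
    move=> My; apply: u_ge0_out => /OM /= yM.
    have := le_trans (sqnorm_ge_norm y) yM.
    have : (M + 1) ^+ 2 <= `|y| ^+ 2 by rewrite ler_sqr ?nnegrE ?addr_ge0// ltW.
    nra.
  have ny0 : `|p| + M + 1 <= `|y0|.
    by apply: le_trans (norm_coord_le y0 0); rewrite mxE ler_norm.
  have uD : 0 <= u (p + y0).
    by apply: out; have := lerB_normD y0 p; rewrite [y0 + p]addrC; lra.
  have uB : 0 <= u (p - y0).
    by apply: out; have := lerB_dist y0 p; rewrite [`|y0 - p|]distrC; lra.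
  have := Lu_ge0 p Op; apply/negP; rewrite -ltNge.
  apply: (@Lmu_lt0 _ mu n u p y0) => //; first exact: ltW.
  - exact: (laplacian_ge0_at_min Omega_open u_C2 Op).
  - by move=> y; have := pmin (p + y); have := pmin (p - y); lra.
  - by lra.
split=> // x0 Ox0 ux0.
suff uz x : u x = 0 by split => [x _|_ x]; exact: uz.
apply/eqP; rewrite eq_le u0 andbT leNgt; apply/negP => ux.
have := Lu_ge0 x0 Ox0; apply/negP; rewrite -ltNge.
(* The displacement reaches [x], where [u > 0], while the opposite point contributes a nonnegative
   value. *)
apply: (@Lmu_lt0 _ mu n u x0 (x - x0)) => //.
- by rewrite ux0.
- by apply: (laplacian_ge0_at_min Omega_open u_C2 Ox0) => y; rewrite ux0.
- by move=> y; rewrite ux0 mulr0 addr_ge0.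
- by rewrite ux0 mulr0 [x0 + _]addrC subrK ltr_pwDl.
Qed.
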